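(* There exist infinitely many pairwise non-isomorphic finite connected bichromatic graphs that are locally like the Weyl graph $\mathbb{W}(F_4)$.
   Context: All graphs are simple and undirected. A bichromatic graph is a graph in which each vertex is designated either short or long (adjacent vertices may have the same type); isomorphisms of bichromatic graphs preserve the type, and induced subgraphs inherit it. The local graph at a vertex $x$ is the induced subgraph on the set $x^\perp$ of neighbors of $x$. The Weyl graph $\mathbb{W}(F_4)$ is the bichromatic graph whose vertices are the $24$ reflections of the Weyl group of the root system of type $F_4$, two distinct reflections being adjacent if and only if they commute, where reflections in short (respectively long) roots are the short (respectively long) vertices. All its local graphs at short vertices are isomorphic to $\mathbb{W}(B_3)$ and all its local graphs at long vertices are isomorphic to $\mathbb{W}(C_3)$. Here $\mathbb{W}(B_3)$ is the bichromatic graph with vertices $y_{i,j}$, $1\leqslant i,j\leqslant 3$, where the $y_{i,i}$ are short and the $y_{i,j}$ with $i\neq j$ are long, and distinct $y_{i,j},y_{k,l}$ are adjacent if and only if $\{i,j\}\cap\{k,l\}=\emptyset$ or $(k,l)=(j,i)$; $\mathbb{W}(C_3)$ is obtained from $\mathbb{W}(B_3)$ by exchanging short and long. A bichromatic graph $\Gamma$ is locally like $\mathbb{W}(F_4)$ if the local graph at every short vertex is isomorphic (as a bichromatic graph) to $\mathbb{W}(B_3)$ and the local graph at every long vertex is isomorphic to $\mathbb{W}(C_3)$. *)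

(* Defs.v *)
From HB Require Import structures.
From mathcomp Require Import all_boot.
Set Implicit Arguments.
Unset Strict Implicit.
Unset Printing Implicit Defensive.

(* Finite, simple, undirected; a vertex is short when it is not long. *)
Record bichromatic := Bichromatic {
  vertex :> finType;
  adj : rel vertex;
  long : pred vertex;
  adj_sym : symmetric adj;
  adj_irr : irreflexive adj
}.

Definition short (G : bichromatic) : pred G := fun x => ~~ long x.

Definition isomorphic (G H : bichromatic) : Prop :=
  exists f : G -> H,
    [/\ bijective f,
        forall x y : G, adj (f x) (f y) = adj x y
      & forall x : G, long (f x) = long x].

Definition connected (G : bichromatic) : Prop :=
  0 < #|G| /\ forall x y : G, connect (@adj G) x y.

Section Induced.
Variables (G : bichromatic) (A : {set G}).

Let iadj : rel {x : G | x \in A} := fun x y => adj (val x) (val y).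
Let ilong : pred {x : G | x \in A} := fun x => long (val x).

Fact iadj_sym : symmetric iadj.
Proof. by move=> x y; apply: adj_sym. Qed.

Fact iadj_irr : irreflexive iadj.
Proof. by move=> x; apply: adj_irr. Qed.

Definition induced : bichromatic := Bichromatic ilong iadj_sym iadj_irr.
End Induced.

Definition perp (G : bichromatic) (x : G) : {set G} := [set y | adj x y].

Definition local_graph (G : bichromatic) (x : G) : bichromatic :=
  induced (perp x).

Definition exchange (G : bichromatic) : bichromatic :=
  Bichromatic (@short G) (@adj_sym G) (@adj_irr G).

(* The pair (i, j) is the vertex y_{i,j}, with indices in {0, 1, 2}. *)
Definition B3_adj : rel ('I_3 * 'I_3) := fun u v =>
  (u != v) &&
  ((([set u.1; u.2] :&: [set v.1; v.2]) == set0) || (v == (u.2, u.1))).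

Definition B3_long : pred ('I_3 * 'I_3) := fun u => u.1 != u.2.

Fact B3_adj_sym : symmetric B3_adj.
Proof.
move=> [i j] [k l]; rewrite /B3_adj /= eq_sym setIC; congr (_ && (_ || _)).
by rewrite !xpair_eqE [k == j]eq_sym [l == i]eq_sym andbC.
Qed.

Fact B3_adj_irr : irreflexive B3_adj.
Proof. by move=> u; rewrite /B3_adj eqxx. Qed.

Definition WB3 : bichromatic := Bichromatic B3_long B3_adj_sym B3_adj_irr.

Definition WC3 : bichromatic := exchange WB3.

Definition locally_like_WF4 (G : bichromatic) : Prop :=
  forall x : G,
    (short x -> isomorphic (local_graph x) WB3) /\
    (long x -> isomorphic (local_graph x) WC3).

(* Main.v *)
Require Import Defs.
From mathcomp Require Import all_boot.
From mathcomp Require Import ssralg finalg zmodp.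
Set Implicit Arguments.
Unset Strict Implicit.
Unset Printing Implicit Defensive.

Import GRing.Theory.
Local Open Scope ring_scope.

(** Why the theorem holds.  W(B_3) is a triangle of short vertices in which
    every vertex carries one further triangle, whose two other vertices are
    long; W(C_3) is the same with the types exchanged.  Hence, in a graph
    locally like W(F_4), the short vertices fall into disjoint K_4s, so do the
    long ones, and the edges of the short K_4s correspond one-to-one to those
    of the long K_4s: corresponding edges span a K_4, and these are all the
    adjacencies between short and long vertices.  The only condition left is
    that the three edges at a vertex of a K_4 correspond to edges of three
    different K_4s.

    This is easy to satisfy.  Take short K_4s S_i and long K_4s L_i indexed by
    i in a finite abelian group Z, each a copy of Klein's four-group V.  The
    edges {x, x + v} of V fall into three perfect matchings, one for each
    nonzero v = v_0, v_1, v_2.  For distinct o_0, o_1, o_2 in Z, let the edge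
    {x, x + v_c} of S_i correspond to the edge {x, x + v_c} of L_(i + o_c).
    The three edges at x have different directions v_c, so the condition is
    the injectivity of o; this gives [klein_graph_local].

    With Z = Z/(n+3) and o_c = c the graph is connected, since o_0 = 0 joins
    S_i to L_i and o_1 = 1 joins S_i to L_(i+1).  It has 8(n+3) vertices, so
    different n give non-isomorphic graphs. *)

(** * Coordinates on W(B_3) *)

(** Adjacency of W(B_3) in the coordinates c, t with u = y_{c-t,c+t}, taken
    modulo 3: c numbers the three triangles attached to the short one, and
    t = 0 marks the short vertex of such a triangle. *)
Definition windmill_adj (c t d s : 'I_3) : bool :=
  if (t == 0) && (s == 0) then c != d else (c == d) && (t != s).

Lemma disjoint_pairs (T : finType) (a b c d : T) :
  ([set a; b] :&: [set c; d] == set0) = [&& a != c, a != d, b != c & b != d].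
Proof.
by rewrite setI_eq0 disjoints_subset subUset !sub1set !inE !negb_or -!andbA.
Qed.

(** Since the three cases are closed terms, an identity between residues modulo
    3 reduces to finitely many that hold by evaluation. *)
Lemma ord3P (P : 'I_3 -> Prop) :
  P 0 -> P 1 -> P (- 1) -> forall c, P c.
Proof.
move=> P0 P1 P2 [[|[|[|//]]] lt_c].
- by have <-: 0 = Ordinal lt_c by apply: val_inj.
- by have <-: 1 = Ordinal lt_c by apply: val_inj.
- by have <-: - 1 = Ordinal lt_c by apply: val_inj.
Qed.

Lemma B3_adjE (c t d s : 'I_3) :
  B3_adj (c - t, c + t) (d - s, d + s) = windmill_adj c t d s.
Proof.
rewrite /B3_adj /windmill_adj disjoint_pairs /= !xpair_eqE.
by move: c t d s; do 4!apply: ord3P.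
Qed.

Lemma B3_longE (c t : 'I_3) : B3_long (c - t, c + t) = (t != 0).
Proof. by rewrite /B3_long /=; move: c t; do 2!apply: ord3P. Qed.

(** The inverse change of coordinates is c = -(i + j), t = i - j, because
    -2 = 1 modulo 3. *)
Lemma B3_coord (u : 'I_3 * 'I_3) :
  (- (u.1 + u.2) - (u.1 - u.2), - (u.1 + u.2) + (u.1 - u.2)) = u.
Proof.
case: u => i j /=; apply/eqP; rewrite xpair_eqE.
by move: i j; do 2!apply: ord3P.
Qed.

(** A local graph is recognized from a parametrization of the neighbours: this
    avoids writing down the inverse on the subtype of neighbours. *)
Lemma local_graph_isomorphic (G H : bichromatic) (x : G) (g : H -> G) :
    injective g ->
    (forall y, adj x y = [exists u, y == g u]) ->
    (forall u w, adj (g u) (g w) = adj u w) ->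
    (forall u, long (g u) = long u) ->
  isomorphic (local_graph x) H.
Proof.
move=> g_inj g_im g_adj g_long.
have gP u : g u \in perp x by rewrite inE g_im; apply/existsP; exists u.
pose h u : local_graph x := Sub (g u) (gP u).
have surj (y : local_graph x) : exists u, y == h u.
  have := valP y; rewrite inE g_im => /existsP[u /eqP yu].
  by exists u; apply/eqP/val_inj.
pose k y := xchoose (surj y).
have kK : cancel k h by move=> y; rewrite -(eqP (xchooseP (surj y))).
have h_inj : injective h by move=> u w /(congr1 val) /g_inj.
have hK : cancel h k by move=> u; apply: h_inj; rewrite kK.
exists k; split; first by exists h.
  by move=> y z; rewrite -{2}(kK y) -{2}(kK z) -g_adj.
by move=> y; rewrite -{2}(kK y) -g_long.
Qed.

(** * The graphs *)

Notation klein := (bool * bool)%type.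

(** The directions of the edges of a K_4: the pairs {x, x + dir c} form one of
    its three perfect matchings. *)
Definition dir (c : 'I_3) : klein := (c != 1, c != 0).

Lemma dir_inj : injective dir.
Proof. by move=> c d /eqP cd; apply/eqP; move: c d cd; do 2!apply: ord3P. Qed.

Lemma eq_add_dir x c : (x == x + dir c) = false.
Proof. by case: x => [[] []]; move: c; apply: ord3P. Qed.

Lemma dir_onto (x : klein) : x != 0 -> exists c, x = dir c.
Proof.
by case: x => [[] []] // _; [exists (- 1) | exists 0 | exists 1].
Qed.

Lemma addkK (x y : klein) : x + y + y = x.
Proof. by case: x y => [[] []] [[] []]. Qed.

Section KleinGraph.

Variables (Z : finZmodType) (off : 'I_3 -> Z).

(** The K_4 of the other type that is joined to the K_4 of index i and type b
    (true for long) along the edges of direction c. *)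
Definition shift (b : bool) (i : Z) (c : 'I_3) : Z :=
  if b then i - off c else i + off c.

Lemma shiftK b i c : shift (~~ b) (shift b i c) c = i.
Proof. by case: b; rewrite /= ?addrK ?subrK. Qed.

Definition klein_adj : rel (bool * Z * klein) := fun p q =>
  let: (b, i, x) := p in let: (b', j, y) := q in
  if b == b' then (i == j) && (x != y)
  else [exists c, (j == shift b i c) && ((y == x) || (y == x + dir c))].

Lemma klein_adj_sym : symmetric klein_adj.
Proof.
suff sub p q : klein_adj p q -> klein_adj q p.
  by move=> p q; apply/idP/idP; apply: sub.
case: p q => [[b i] x] [[b' j] y] /=; rewrite ![b' == b]eq_sym.
case: (b =P b') => [_ | /eqP nbb']; first by rewrite eq_sym [x == y]eq_sym.
have -> : b' = ~~ b by case: b b' nbb' => [] [].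
case/existsP=> c /andP[/eqP-> xy]; apply/existsP; exists c.
by case/orP: xy => /eqP->; rewrite shiftK ?addkK !eqxx ?orbT.
Qed.

Lemma klein_adj_irr : irreflexive klein_adj.
Proof. by move=> [[b i] x] /=; rewrite !eqxx. Qed.

Definition klein_graph : bichromatic :=
  Bichromatic (fun p : bool * Z * klein => p.1.1) klein_adj_sym klein_adj_irr.

(** The neighbour of (b, i, x) whose coordinates in W(B_3) are c and t:
    for t = 0, it is the other end of the edge of direction c at x; for
    t = 1 and t = -1, the two ends of the corresponding edge. *)
Definition neighbour (b : bool) (i : Z) (x : klein) (c t : 'I_3) :
    klein_graph :=
  if t == 0 then (b, i, x + dir c)
  else (~~ b, shift b i c, if t == 1 then x else x + dir c).

Lemma neighbour_long b i x c t :
  long (neighbour b i x c t) = b (+) (t != 0).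
Proof. by rewrite /neighbour; case: (t == 0); case: b. Qed.

Lemma perp_neighbour b i x y :
  @adj klein_graph (b, i, x) y = [exists c, exists t, y == neighbour b i x c t].
Proof.
apply/idP/idP; last first.
  case/existsP=> c /existsP[t /eqP->]; rewrite /neighbour /=.
  case: eqP => _ /=; first by rewrite !eqxx eq_add_dir.
  have -> : (b == ~~ b) = false by case: b.
  by apply/existsP; exists c; case: ifP; rewrite !eqxx ?orbT.
case: y => [[b' j] y] /=; case: (b =P b') => [<- | /eqP nbb'].
  case/andP=> /eqP<- nxy; have [|c yx] := @dir_onto (y - x).
    by rewrite subr_eq0 eq_sym.
  apply/existsP; exists c; apply/existsP; exists 0.
  by rewrite /neighbour /= -yx addrC subrK.
have -> : b' = ~~ b by case: b b' nbb' => [] [].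
case/existsP=> c /andP[/eqP-> xy]; apply/existsP; exists c; apply/existsP.
by case/orP: xy => /eqP->; [exists 1 | exists (- 1)].
Qed.

Hypothesis off_inj : injective off.

Lemma shift_inj b i : injective (shift b i).
Proof.
by case: b => c d /addrI; [move=> /oppr_inj|]; apply: off_inj.
Qed.

(** The neighbourhood is a windmill: the vertices with t = 0 lie in the K_4 of
    (b, i, x); those with the same c and t <> 0 lie in one K_4 of the other
    type, and different c give different such K_4s because off is injective.
    Between the two types, adjacency only involves the direction c, and reduces
    to a finite check in Klein's four-group. *)
Lemma neighbour_adj b i x c t d s :
  adj (neighbour b i x c t) (neighbour b i x d s) = windmill_adj c t d s.
Proof.
have typeN : (b == ~~ b) = false by case: b.
(* As off is injective, two K_4s of different types are joined along at most
   one direction. *)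
have across e y z : [exists e', (shift b i e == shift b i e')
    && ((z == y) || (z == y + dir e'))] = (z == y) || (z == y + dir e).
  apply/existsP/idP => [[e' /andP[/eqP/shift_inj<-]] //|yz].
  by exists e; rewrite eqxx.
have same_K4 e e' : adj (neighbour b i x e 0) (neighbour b i x e' 0)
    = windmill_adj e 0 e' 0.
  by rewrite /= !eqxx (inj_eq (addrI x)) (inj_eq dir_inj).
have mixed e e' r : r != 0 -> adj (neighbour b i x e 0) (neighbour b i x e' r)
    = windmill_adj e 0 e' r.
  rewrite /neighbour => r0; rewrite (negPf r0) /= typeN across.
  case: (x) => [[] []]; move: e e' r r0; by do 3!apply: ord3P.
have both_across e e' r r' : r != 0 -> r' != 0 ->
    adj (neighbour b i x e r) (neighbour b i x e' r') = windmill_adj e r e' r'.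
  rewrite /neighbour /windmill_adj => r0 r'0; rewrite (negPf r0) (negPf r'0) /=.
  rewrite eqxx (inj_eq (@shift_inj b i)); case: (eqVneq e e') => //= <-.
  case: (x) => [[] []]; move: e r r' r0 r'0; by do 3!apply: ord3P.
have windmill_sym e r e' r' : windmill_adj e r e' r' = windmill_adj e' r' e r.
  rewrite /windmill_adj [e == e']eq_sym [r == r']eq_sym.
  by case: (r == 0); case: (r' == 0).
case: (eqVneq t 0) => [-> | t0]; case: (eqVneq s 0) => [-> | s0].
- exact: same_K4.
- exact: mixed.
- by rewrite adj_sym windmill_sym; apply: mixed.
- exact: both_across.
Qed.

Lemma neighbour_inj b i x c t d s :
  neighbour b i x c t = neighbour b i x d s -> c = d /\ t = s.
Proof.
rewrite /neighbour; case: (eqVneq t 0) => [-> | t0];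
  case: (eqVneq s 0) => [-> | s0].
- by move=> /(congr1 snd)/addrI/dir_inj->.
- by case: b => -[].
- by case: b => -[].
move=> /[dup] /(congr1 (fun p => p.1.2))/shift_inj<- /(congr1 snd)/eqP /= ts.
split=> //; apply/eqP; case: x ts => [[] []];
  by move: t s c t0 s0; do 3!apply: ord3P.
Qed.

(** One argument serves both types, as exchanging them only replaces off by its
    opposite, which [shift] takes care of. *)
Theorem klein_graph_local : locally_like_WF4 klein_graph.
Proof.
move=> [[b i] x].
pose g (u : 'I_3 * 'I_3) := neighbour b i x (- (u.1 + u.2)) (u.1 - u.2).
have g_inj : injective g.
  by move=> u w /neighbour_inj[cu tu]; rewrite -(B3_coord u) cu tu B3_coord.
have g_im y : @adj klein_graph (b, i, x) y = [exists u, y == g u].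
  rewrite perp_neighbour; apply/existsP/existsP => [[c /existsP[t /eqP->]]|].
    exists (c - t, c + t); apply/eqP; rewrite /g /=.
    by congr neighbour; apply/eqP; move: c t; do 2!apply: ord3P.
  by case=> u yu; exists (- (u.1 + u.2)); apply/existsP; exists (u.1 - u.2).
have g_adj u w : adj (g u) (g w) = B3_adj u w.
  by rewrite neighbour_adj -B3_adjE !B3_coord.
have g_long u : long (g u) = b (+) B3_long u.
  by rewrite neighbour_long -[in RHS](B3_coord u) B3_longE.
rewrite /short /=; split=> [/negPf b0 | b1].
  by apply: (@local_graph_isomorphic _ WB3 _ g) => // u; rewrite g_long b0.
by apply: (@local_graph_isomorphic _ WC3 _ g) => // u; rewrite g_long b1.
Qed.

End KleinGraph.

(** * The cyclic family *)

Definition cyclic_graph (n : nat) : bichromatic :=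
  klein_graph (fun c : 'I_3 => inZp c : 'I_n.+3).

Lemma cyclic_graph_local n : locally_like_WF4 (cyclic_graph n).
Proof.
apply: klein_graph_local => c d /(congr1 val) /=.
have small (e : 'I_3) : (e < n.+3)%N by apply: leq_trans (ltn_ord e) _.
by rewrite !modn_small // => /val_inj.
Qed.

Lemma cyclic_graph_connected n : connected (cyclic_graph n).
Proof.
split; first by apply/card_gt0P; exists (false, 0, 0).
pose e := @adj (cyclic_graph n).
have esym : connect_sym e by apply: sym_connect_sym; apply: adj_sym.
suff to0 p : connect e (false, 0, 0) p.
  by move=> p q; apply: connect_trans (to0 q); rewrite esym.
have inside b i x y : connect e (b, i, x) (b, i, y).
  case: (eqVneq x y) => [-> // | xy].
  by apply: connect1; rewrite /e /= !eqxx.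
have across i (c : 'I_3) x : connect e (false, i, x) (true, i + inZp c, x).
  by apply: connect1; apply/existsP; exists c; rewrite !eqxx.
have level i x : connect e (false, i, x) (true, i, x).
  have := across i 0 x.
  have -> : inZp (0 : 'I_3)%R = 0 :> 'I_n.+3 by apply: val_inj.
  by rewrite addr0.
have next i x : connect e (false, i, x) (false, i + 1, x).
  apply: (@connect_trans _ _ (true, i + 1, x)); last by rewrite esym level.
  have := across i 1 x.
  by have -> : inZp (1 : 'I_3)%R = 1 :> 'I_n.+3 by apply: val_inj.
have short_index k : connect e (false, 0, 0) (false, k%:R, 0).
  by elim: k => [|k IHk] //; rewrite mulrSr;
    apply: connect_trans IHk (next _ _).
case: p => [[b i] x]; rewrite -[i]natr_Zp.
apply: connect_trans (inside b _ 0 x).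
by case: b; [apply: connect_trans (level _ _) |]; apply: short_index.
Qed.

Theorem corollary11 :
  exists G : nat -> bichromatic,
    (forall n : nat, connected (G n) /\ locally_like_WF4 (G n)) /\
    (forall m n : nat, m <> n -> ~ isomorphic (G m) (G n)).
Proof.
exists cyclic_graph; split=> [n | m n neq_mn [f [f_bij _ _]]].
  by split; [apply: cyclic_graph_connected | apply: cyclic_graph_local].
have := bij_eq_card f_bij; rewrite !card_prod !card_ord card_bool.
by move/eqP; rewrite eqn_pmul2r // eqn_pmul2l // => /eqP[].
Qed.
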